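(* Let $E$ be a real Banach space and let $(f_n)_{n\in\mathbb N}\subset E^*$ satisfy $\sup_n\|f_n\|\le 1$ and $\|x\|=\sup_{n\in\mathbb N}|f_n(x)|$ for all $x\in E$. Let $V$, $V^\sharp$, $Y$, $E_{c_0}$ and $J$ be the objects associated with $(f_n)$ as defined in the context, and assume that $J:E\to Y^*$, $Jx(y)=y(x)$, is an isometric isomorphism (onto). Then the following assertions are equivalent. (i) The canonical restriction map $\Lambda:Y\to E_{c_0}^*$, $\Lambda(y)=y|_{E_{c_0}}$, is an isometric isomorphism. (ii) For every $x\in E$ there exists a sequence $(x_k)\subset E_{c_0}$ such that $\sup_k\|x_k\|<\infty$ and $f_n(x_k)\to f_n(x)$ as $k\to\infty$ for every $n\in\mathbb N$. When these conditions hold, the sequence in (ii) may be chosen with $\sup_k\|x_k\|\le\|x\|$. Moreover, on bounded sequences in $E$, coordinatewise convergence on the family $(f_n)$ is equivalent to convergence in $\sigma(E,Y)$; that is, for a bounded sequence $(z_k)\subset E$ and $z\in E$, one has $f_n(z_k)\to f_n(z)$ for all $n$ if and only if $y(z_k)\to y(z)$ for all $y\in Y$.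
   Context: All Banach spaces are real. Given $E$ and $(f_n)$ as in the claim: - $V:E\to\ell^\infty$, $Vx=(f_n(x))_{n\in\mathbb N}$ (an isometric embedding). - $V^\sharp:\ell^1\to E^*$, $V^\sharp\xi=\sum_{n=1}^\infty \xi_n f_n$. - $Y:=V^\sharp(\ell^1)\subset E^*$, equipped with the quotient norm inherited from $\ell^1/\ker V^\sharp$, i.e. $\|y\|_Y=\inf\{\|\xi\|_{\ell^1}: V^\sharp\xi=y\}$ (not, a priori, the norm of $E^*$). - $E_{c_0}:=\{x\in E: Vx\in c_0\}$, a closed subspace of $E$ with the norm of $E$. - $J:E\to Y^*$, $Jx(y)=y(x)$, where $Y^*$ is the dual of $Y$ with its quotient norm; $J$ is contractive. *)

(* Defs.v *)
From HB Require Import structures.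
From mathcomp Require Import all_boot all_order all_algebra.
From mathcomp Require Import all_classical all_reals all_analysis.

Set Implicit Arguments.
Unset Strict Implicit.
Unset Printing Implicit Defensive.

Import Order.TTheory GRing.Theory Num.Theory.
Import numFieldNormedType.Exports.

Local Open Scope classical_set_scope.
Local Open Scope ring_scope.

Definition isometric_isomorphism (R : realType) (U W : normedModType R)
    (T : U -> W) : Prop :=
  [/\ linear T, bijective T & forall u, `|T u| = `|u|].

Lemma linear_bound_continuous (R : realType) (W : normedModType R) (g : W -> R^o) (C : R) :
  linear g -> (forall w, `|g w| <= C * `|w|) -> continuous g.
Proof.
move=> lg gC.
pose lgl : {linear W -> R^o} := HB.pack g (GRing.isLinear.Build _ _ _ _ _ lg).
change (continuous lgl); apply/linear_bounded_continuous/bounded_funP => r.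
exists (`|C| * r) => w wr; apply: (le_trans (gC w)).
apply: (@le_trans _ _ (`|C| * `|w|)); first by rewrite ler_wpM2r// ler_norm.
by rewrite ler_wpM2l.
Qed.

Section Dual.
Variables (R : realType) (X : normedModType R).

Definition dual_pred : {pred X -> R^o} :=
  [pred g : X -> R^o | `[< linear g /\ continuous g >]].

Record dual : Type := Dual {
  dual_fun :> X -> R^o;
  _ : dual_fun \in dual_pred }.

HB.instance Definition _ := [isSub for dual_fun].
HB.instance Definition _ := [Choice of dual by <:].

Lemma dual_submod_closed : submod_closed dual_pred.
Proof.
split.
  apply/asboolP; split; last by move=> x; exact: cvg_cst.
  by move=> a u v; rewrite scaler0 addr0.
move=> a g h /asboolP[lg cg] /asboolP[lh ch]; apply/asboolP; split.
  move=> b u v.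
  change (a *: g (b *: u + v) + h (b *: u + v) =
          b *: (a *: g u + h u) + (a *: g v + h v)).
  rewrite lg lh !scalerDr !scalerA (mulrC a b).
  by rewrite addrACA.
move=> x.
have -> : a *: g + h = (fun y => a *: g y + h y) by [].
by apply: cvgD; [apply: cvgZl_tmp; exact: cg|exact: ch].
Qed.

HB.instance Definition _ := GRing.isSubmodClosed.Build _ _ dual_pred
  dual_submod_closed.
HB.instance Definition _ := [SubChoice_isSubLmodule of dual by <:].

Lemma dual_fun_linear (g : dual) : linear g.
Proof. by case: g => g /= /asboolP[]. Qed.

HB.instance Definition _ (g : dual) :=
  GRing.isLinear.Build R X R^o _ (dual_fun g) (dual_fun_linear g).

Lemma dual_continuous (g : dual) : continuous g.
Proof. by case: g => g /= /asboolP[]. Qed.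

Lemma dualP (g h : dual) : (forall x, g x = h x) -> g = h.
Proof. by move=> gh; apply/val_inj/funext. Qed.

Lemma dualDE (g h : dual) x : (g + h) x = g x + h x. Proof. by []. Qed.
Lemma dualZE a (g : dual) x : (a *: g) x = a * g x. Proof. by []. Qed.
Lemma dual0E x : (0 : dual) x = 0. Proof. by []. Qed.
Lemma dualNE (g : dual) x : (- g) x = - g x. Proof. by []. Qed.

Definition mkdual (g : X -> R^o) (lg : linear g) (cg : continuous g) : dual :=
  @Dual g (introT (asboolP _) (conj lg cg)).

Definition dual_norm (g : dual) : R :=
  sup [set `|g x| | x in [set x : X | `|x| <= 1]].

Lemma dual_has_sup (g : dual) :
  has_sup [set `|g x| | x in [set x : X | `|x| <= 1]].
Proof.
split; first by exists `|g 0|, 0 => //=; rewrite normr0.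
have /bounded_funP/(_ 1)[M gM] :=
  @continuous_linear_bounded _ _ _ 0 g (@dual_continuous g 0).
by exists M => _ [x /= x1 <-]; exact: gM.
Qed.

Lemma ler_dual_norm1 (g : dual) x : `|x| <= 1 -> `|g x| <= dual_norm g.
Proof.
by move=> x1; apply: ub_le_sup; [exact: (dual_has_sup g).2|exists x].
Qed.

Lemma dual_norm_ge0 (g : dual) : 0 <= dual_norm g.
Proof. by apply: le_trans (@ler_dual_norm1 g 0 _); rewrite ?normr0. Qed.

Lemma dual_norm_apply (g : dual) x : `|g x| <= dual_norm g * `|x|.
Proof.
have [->|x0] := eqVneq x 0; first by rewrite linear0 !normr0 mulr0.
have nx0 : 0 < `|x| by rewrite normr_gt0.
rewrite -ler_pdivrMr//.
have := @ler_dual_norm1 g (`|x|^-1 *: x).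
rewrite normrZ normfV normr_id mulVf ?gt_eqF// => /(_ (lexx _)).
by rewrite linearZ normrZ normfV normr_id mulrC.
Qed.

Lemma dual_norm_le (g : dual) (C : R) : 0 <= C ->
  (forall x, `|g x| <= C * `|x|) -> dual_norm g <= C.
Proof.
move=> C0 gC; apply: ge_sup; first exact: (dual_has_sup g).1.
move=> _ [x /= x1 <-]; apply: le_trans (gC x) _.
by rewrite -[leRHS]mulr1 ler_wpM2l.
Qed.

Lemma dual_normD (g h : dual) : dual_norm (g + h) <= dual_norm g + dual_norm h.
Proof.
apply: dual_norm_le => [|x]; first by rewrite addr_ge0 ?dual_norm_ge0.
by rewrite mulrDl (le_trans (ler_normD _ _))// lerD ?dual_norm_apply.
Qed.

Let dual_normZ_le a (g : dual) : dual_norm (a *: g) <= `|a| * dual_norm g.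
Proof.
apply: dual_norm_le => [|x]; first by rewrite mulr_ge0 ?dual_norm_ge0.
by rewrite dualZE normrM -mulrA ler_wpM2l// dual_norm_apply.
Qed.

Lemma dual_normZ a (g : dual) : dual_norm (a *: g) = `|a| * dual_norm g.
Proof.
apply/eqP; rewrite eq_le dual_normZ_le/=.
have [->|a0] := eqVneq a 0; first by rewrite normr0 mul0r dual_norm_ge0.
have := dual_normZ_le a^-1 (a *: g).
by rewrite scalerA mulVf// scale1r normfV ler_pdivlMl ?normr_gt0.
Qed.

Lemma dual_norm0_eq0 (g : dual) : dual_norm g = 0 -> g = 0.
Proof.
move=> g0; apply: dualP => x; apply/eqP; rewrite -normr_le0.
by have := dual_norm_apply g x; rewrite g0 mul0r.
Qed.

HB.instance Definition _ := Lmodule_isNormed.Build R dual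
  dual_normD dual_normZ dual_norm0_eq0.

Lemma dual_normE (g : dual) :
  `|g| = sup [set `|g x| | x in [set x : X | `|x| <= 1]].
Proof. by []. Qed.

Lemma dual_norm_apply_le (g : dual) x : `|g x| <= `|g| * `|x|.
Proof. exact: dual_norm_apply. Qed.

Lemma dual_complete (F : set_system dual) :
  ProperFilter F -> cauchy F -> cvg F.
Proof.
move=> FF /cauchy_ballP Fc.
have FN (e : R) : 0 < e ->
    exists2 A, F A & forall g h : dual, A g -> A h -> `|g - h| < e.
  move=> /Fc [[A B] /= [FA FB] AB]; exists (A `&` B); first exact: filterI.
  move=> g h [Ag _] [_ Bh]; have := AB (g, h) (conj Ag Bh).
  by rewrite -ball_normE.
have evN (e : R) x : 0 < e -> exists2 A, F A &
    forall g h : dual, A g -> A h -> `|g x - h x| <= e * `|x|.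
  move=> /FN[A FA Ae]; exists A => // g h Ag Ah.
  apply: le_trans (dual_norm_apply_le (g - h) x) _.
  by rewrite ler_wpM2r// ltW// Ae.
have evc x : cvg ((fun g : dual => g x) @ F).
  apply: cauchy_cvg; apply/cauchy_ballP => e e0.
  have x1 : 0 < `|x| + 1 by rewrite ltr_wpDl.
  have [A FA Ae] := evN _ x (divr_gt0 e0 x1).
  exists (((fun g : dual => g x) @` A), ((fun g : dual => g x) @` A)) => /=.
    by split; apply: (@filterS dual F _ A) => // g Ag; exists g.
  move=> [r s] [/= [g Ag <-] [h Ah <-]]; rewrite -ball_normE/=.
  apply: le_lt_trans (Ae _ _ Ag Ah) _.
  by rewrite mulrAC ltr_pdivrMr// ltr_pM2l// ltrDl.
pose l x : R^o := lim ((fun g : dual => g x) @ F).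
have lE x : (fun g : dual => g x) @ F --> l x by exact: evc.
have ll : linear l.
  move=> a u v; rewrite [LHS]/l; apply: cvg_lim; first exact: norm_hausdorff.
  rewrite (_ : (fun g : dual => g _) = (fun g : dual => a *: g u + g v)); last first.
    by apply/funext => g; rewrite linearP.
  by apply: cvgD (lE v); apply: cvgZl_tmp (lE u).
have lN (e : R) : 0 < e ->
    exists2 A, F A & forall g x, A g -> `|g x - l x| <= e * `|x|.
  move=> e0; have [A FA Ae] := FN e e0; exists A => // g x Ag.
  rewrite distrC; apply: (@closed_cvg _ R^o _ _ (fun h : dual => h x)
    [set r | `|r - g x| <= e * `|x|] _ _ _ (lE x)) => //.
    apply: (@closed_comp R^o R^o (fun r => `|r - g x|) [set r | r <= e * `|x|]).
      move=> r _; apply: (@cvg_norm R R^o); apply: cvgB; [exact: cvg_id|exact: cvg_cst].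
    exact: closed_le.
  apply: filterS FA => h Ah /=; apply: le_trans (dual_norm_apply_le (h - g) x) _.
  by rewrite ler_wpM2r// ltW// Ae.
have lc : continuous l.
  have [A FA Ag] := lN 1 ltr01.
  have [g0 Ag0] := @filter_ex _ F _ A FA.
  pose ml : {linear X -> R^o} := HB.pack l (GRing.isLinear.Build _ _ _ _ _ ll).
  change (continuous ml); apply/linear_bounded_continuous/bounded_funP => r.
  exists ((1 + `|g0|) * r) => x xr.
  rewrite -(subrK (g0 x) (ml x)) (le_trans (ler_normD _ _))//.
  apply: (@le_trans _ _ (1 * `|x| + `|g0| * `|x|)).
    by rewrite lerD ?dual_norm_apply_le// distrC Ag.
  by rewrite -mulrDl ler_wpM2l// addr_ge0.
apply/cvg_ex; exists (mkdual ll lc); apply/cvgrPdist_le => e e0.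
have [A FA Ag] := lN e e0; apply: filterS FA => g Agg.
by rewrite distrC; apply: dual_norm_le => [|x]; [exact: ltW|exact: Ag].
Qed.

HB.instance Definition _ := Uniform_isComplete.Build dual dual_complete.

End Dual.

Section SequenceSpaces.
Variable R : realType.

Definition c0 : set (nat -> R) := [set u | u @ \oo --> (0 : R)].

Definition ell1 : set (nat -> R) := [set xi | cvgn (series (fun n => `|xi n|) : R^nat)].

Definition ell1_norm (xi : nat -> R) : R := limn (series (fun n => `|xi n|) : R^nat).

Lemma ell1_norm_ge0 xi : ell1 xi -> 0 <= ell1_norm xi.
Proof. by move=> xi1; apply: limr_ge => //; near=> n; apply: sumr_ge0.
Unshelve. all: by end_near. Qed.

Lemma ell1_0 : ell1 (fun=> 0) /\ ell1_norm (fun=> 0) = 0.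
Proof.
have s0 : series (fun n => `|(fun=> 0 : R) n|) = fun=> 0 : R.
  by apply/funext => n; rewrite /series/= big1// => i _; rewrite normr0.
by split; rewrite /ell1/= /ell1_norm s0; [exact: is_cvg_cst|exact: lim_cst].
Qed.

Lemma ell1Z a xi : ell1 xi ->
  ell1 (fun n => a * xi n) /\ ell1_norm (fun n => a * xi n) = `|a| * ell1_norm xi.
Proof.
move=> xi1; rewrite /ell1/= /ell1_norm.
have -> : (fun n => `|a * xi n|) = `|a| *: (fun n => `|xi n|).
  by apply/funext => n; rewrite normrM.
by split; [exact: is_cvg_seriesZ|rewrite lim_seriesZ].
Qed.

Lemma ell1D xi eta : ell1 xi -> ell1 eta ->
  ell1 (fun n => xi n + eta n) /\
  ell1_norm (fun n => xi n + eta n) <= ell1_norm xi + ell1_norm eta.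
Proof.
move=> xi1 eta1; rewrite /ell1/= /ell1_norm.
have c : cvgn (series ((fun n => `|xi n|) + (fun n => `|eta n|))).
  exact: is_cvg_seriesD.
have c1 : cvgn (series (fun n => `|xi n + eta n|)).
  apply: series_le_cvg c => n //; first by rewrite addr_ge0.
  exact: ler_normD.
split => //; rewrite -lim_seriesD//; apply: lim_series_le => // n.
exact: ler_normD.
Qed.

End SequenceSpaces.

Section Objects.
Variables (R : realType) (E : normedModType R) (f : nat -> dual E).

Definition V (x : E) : nat -> R := fun n => f n x.

Definition Ec0_pred : {pred E} := [pred x : E | `[< c0 (V x) >]].

Record Ec0 : Type := MkEc0 {
  Ec0_val :> E;
  _ : Ec0_val \in Ec0_pred }.

HB.instance Definition _ := [isSub for Ec0_val].
HB.instance Definition _ := [Choice of Ec0 by <:].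

Lemma Ec0_submod_closed : submod_closed Ec0_pred.
Proof.
split.
  apply/asboolP; rewrite /c0/= (_ : V 0 = fun=> 0); first exact: cvg_cst.
  by apply/funext => n; rewrite /V linear0.
move=> a x y /asboolP x0 /asboolP y0; apply/asboolP; rewrite /c0/=.
rewrite (_ : V (a *: x + y) = fun n => a *: (V x n : R^o) + V y n); last first.
  by apply/funext => n; rewrite /V linearP.
have -> : 0 = a *: (0 : R^o) + 0 by rewrite scaler0 addr0.
by apply: (@cvgD R R^o) y0; apply: (@cvgZl_tmp R R^o) x0.
Qed.

HB.instance Definition _ := GRing.isSubmodClosed.Build _ _ Ec0_pred
  Ec0_submod_closed.
HB.instance Definition _ := [SubChoice_isSubLmodule of Ec0 by <:].

Definition Ec0_norm (x : Ec0) : R := `|Ec0_val x|.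

Lemma Ec0_normD x y : Ec0_norm (x + y) <= Ec0_norm x + Ec0_norm y.
Proof. exact: ler_normD. Qed.

Lemma Ec0_normZ a x : Ec0_norm (a *: x) = `|a| * Ec0_norm x.
Proof. exact: normrZ. Qed.

Lemma Ec0_norm0_eq0 x : Ec0_norm x = 0 -> x = 0.
Proof. by move=> /normr0_eq0 x0; exact/val_inj. Qed.

HB.instance Definition _ := Lmodule_isNormed.Build R Ec0
  Ec0_normD Ec0_normZ Ec0_norm0_eq0.

Lemma Ec0_normE (x : Ec0) : `|x| = `|Ec0_val x|. Proof. by []. Qed.

Lemma Ec0_val_linear : linear Ec0_val. Proof. by []. Qed.

Definition Vsharp (xi : nat -> R) : dual E :=
  limn (series (fun n => xi n *: f n)).

Hypothesis f_le1 : forall n, `|f n| <= 1.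

Lemma Vsharp_normed xi : ell1 xi -> cvgn [normed series (fun n => xi n *: f n)] /\
  limn [normed series (fun n => xi n *: f n)] <= ell1_norm xi.
Proof.
move=> xi1.
have le n : `|xi n *: f n| <= `|xi n| by rewrite normrZ ler_piMr.
have c : cvgn [normed series (fun n => xi n *: f n)].
  by apply: (@series_le_cvg R (fun n => `|xi n *: f n|)) xi1 => // n.
by split => //; exact: lim_series_le.
Qed.

Lemma Vsharp_cvg xi : ell1 xi ->
  series (fun n => xi n *: f n) @ \oo --> Vsharp xi.
Proof. by move=> /Vsharp_normed[/normed_cvg]. Qed.

Lemma Vsharp_norm_le xi : ell1 xi -> `|Vsharp xi| <= ell1_norm xi.
Proof.
by move=> /Vsharp_normed[c]; apply: le_trans; exact: lim_series_norm.
Qed.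

Lemma VsharpP a xi eta : ell1 xi -> ell1 eta ->
  Vsharp (fun n => a * xi n + eta n) = a *: Vsharp xi + Vsharp eta.
Proof.
move=> xi1 eta1; apply: cvg_lim; first exact: norm_hausdorff.
rewrite (_ : series _ = (fun m => a *: series (fun n => xi n *: f n) m
    + series (fun n => eta n *: f n) m)); last first.
  apply/funext => m; rewrite /series/= scaler_sumr -big_split/=.
  by apply: eq_bigr => i _; rewrite scalerDl scalerA.
by apply: cvgD; [apply: cvgZl_tmp|]; exact: Vsharp_cvg.
Qed.

Lemma Vsharp0 : Vsharp (fun=> 0) = 0.
Proof.
apply: cvg_lim; first exact: norm_hausdorff.
rewrite (_ : series _ = fun=> 0); first exact: cvg_cst.
by apply/funext => n; rewrite /series/= big1// => i _; rewrite scale0r.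
Qed.

(* The bound on the [f n] is a parameter of the space because it is what makes
   the series of [Vsharp] converge, hence [Y] a normed space. *)
Definition Y_pred of (forall n, `|f n| <= 1) : {pred dual E} :=
  [pred y : dual E | `[< (Vsharp @` @ell1 R) y >]].

Record Y : Type := MkY {
  Y_val :> dual E;
  _ : Y_val \in Y_pred f_le1 }.

HB.instance Definition _ := [isSub for Y_val].
HB.instance Definition _ := [Choice of Y by <:].

Lemma Y_submod_closed : submod_closed (Y_pred f_le1).
Proof.
split.
  by apply/asboolP; exists (fun=> 0); [exact: (ell1_0 R).1|exact: Vsharp0].
move=> a _ _ /asboolP[xi xi1 <-] /asboolP[eta eta1 <-]; apply/asboolP.
exists (fun n => a * xi n + eta n); last exact: VsharpP.
exact: (ell1D (ell1Z a xi1).1 eta1).1.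
Qed.

HB.instance Definition _ := GRing.isSubmodClosed.Build _ _ (Y_pred f_le1)
  Y_submod_closed.
HB.instance Definition _ := [SubChoice_isSubLmodule of Y by <:].

Definition Y_norm (y : Y) : R :=
  inf [set ell1_norm xi | xi in [set xi | ell1 xi /\ Vsharp xi = y]].

Lemma Y_has_inf (y : Y) :
  has_inf [set ell1_norm xi | xi in [set xi | ell1 xi /\ Vsharp xi = y]].
Proof.
split; last by exists 0 => _ [xi [/= xi1 _] <-]; exact: ell1_norm_ge0.
by case: y => y /= /asboolP[xi xi1 xiy]; exists (ell1_norm xi), xi.
Qed.

Lemma Y_norm_le (y : Y) xi : ell1 xi -> Vsharp xi = y -> Y_norm y <= ell1_norm xi.
Proof. by move=> xi1 xiy; apply: ge_inf; [exact: (Y_has_inf y).2|exists xi]. Qed.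

Lemma dual_norm_le_Y_norm (y : Y) : `|Y_val y| <= Y_norm y.
Proof.
apply: lb_le_inf; first exact: (Y_has_inf y).1.
by move=> _ [xi [/= xi1 <-] <-]; exact: Vsharp_norm_le.
Qed.

Lemma Y_normD (x y : Y) : Y_norm (x + y) <= Y_norm x + Y_norm y.
Proof.
apply/ler_addgt0Pr => e e0; have e20 : 0 < e / 2 by rewrite divr_gt0.
have [_ [xi [/= xi1 xix] <-] xie] := inf_adherent e20 (Y_has_inf x).
have [_ [eta [/= eta1 etay] <-] etae] := inf_adherent e20 (Y_has_inf y).
have [s1 sle] := ell1D xi1 eta1.
apply: (le_trans (Y_norm_le s1 _)).
  rewrite (_ : (fun n => _) = (fun n => 1 * xi n + eta n)); last first.
    by apply/funext => n; rewrite mul1r.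
  by rewrite VsharpP// scale1r xix etay.
apply: (le_trans sle); rewrite [e]splitr addrACA.
by rewrite lerD// ltW.
Qed.

Let Y_normZ_le a (y : Y) : Y_norm (a *: y) <= `|a| * Y_norm y.
Proof.
apply/ler_addgt0Pr => e e0.
have a1 : 0 < `|a| + 1 by rewrite ltr_wpDl.
have [_ [xi [/= xi1 xiy] <-] xie] := inf_adherent (divr_gt0 e0 a1) (Y_has_inf y).
have [s1 sE] := ell1Z a xi1.
apply: (le_trans (Y_norm_le s1 _)).
  rewrite (_ : (fun n => _) = (fun n => a * xi n + 0)); last first.
    by apply/funext => n; rewrite addr0.
  have := VsharpP a xi1 (ell1_0 R).1 => ->.
  by rewrite Vsharp0 addr0 xiy.
rewrite sE; apply: (@le_trans _ _ (`|a| * (Y_norm y + e / (`|a| + 1)))).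
  by rewrite ler_wpM2l// ltW.
rewrite mulrDr lerD2l mulrA mulrAC ler_piMl ?ltW// ltr_pdivrMr// mul1r.
by rewrite ltrDl.
Qed.

Lemma Y_norm_ge0 (y : Y) : 0 <= Y_norm y.
Proof. exact: le_trans (dual_norm_le_Y_norm y). Qed.

Lemma Y_normZ a (y : Y) : Y_norm (a *: y) = `|a| * Y_norm y.
Proof.
apply/eqP; rewrite eq_le Y_normZ_le/=.
have [->|a0] := eqVneq a 0; first by rewrite normr0 mul0r Y_norm_ge0.
have := Y_normZ_le a^-1 (a *: y).
by rewrite scalerA mulVf// scale1r normfV ler_pdivlMl ?normr_gt0.
Qed.

Lemma Y_norm0_eq0 (y : Y) : Y_norm y = 0 -> y = 0.
Proof.
move=> y0; apply/val_inj/eqP; rewrite -normr_le0 /=.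
by rewrite (le_trans (dual_norm_le_Y_norm y))// y0.
Qed.

HB.instance Definition _ := Lmodule_isNormed.Build R Y
  Y_normD Y_normZ Y_norm0_eq0.

Lemma Y_normE (y : Y) :
  `|y| = inf [set ell1_norm xi | xi in [set xi | ell1 xi /\ Vsharp xi = y]].
Proof. by []. Qed.

Lemma J_linear (x : E) : linear (fun y : Y => y x).
Proof. by []. Qed.

Lemma J_continuous (x : E) : continuous (fun y : Y => y x).
Proof.
apply: (@linear_bound_continuous _ _ _ `|x|) => [|y]; first exact: J_linear.
rewrite mulrC (le_trans (dual_norm_apply_le _ _))// ler_wpM2r//.
exact: dual_norm_le_Y_norm.
Qed.

Definition J (x : E) : dual Y := mkdual (@J_linear x) (@J_continuous x).

Lemma Lambda_linear (y : Y) : linear (fun x : Ec0 => y x).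
Proof. by move=> a u v; exact: (linearP (Y_val y)). Qed.

Lemma Lambda_continuous (y : Y) : continuous (fun x : Ec0 => y x).
Proof.
apply: (@linear_bound_continuous _ _ _ `|Y_val y|) => [|x].
  exact: Lambda_linear.
exact: dual_norm_apply_le.
Qed.

Definition Lambda (y : Y) : dual Ec0 :=
  mkdual (@Lambda_linear y) (@Lambda_continuous y).

End Objects.

(* Main.v *)
(* For (i) => (ii), the isometry [Lambda] makes the functionals [f n] satisfy
   Helly's condition on the unit ball of [Ec0 f], so finitely many values
   [f n x] can be approximated within the ball of radius [`|x|].

   For (ii) => (i), a functional on [Ec0 f], viewed through [V] as a subspace of
   [c0], extends to [c0] with the same norm and is therefore induced by some
   [xi] in [ell1] with [ell1_norm xi] at most that norm: [Lambda] is onto and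
   admits norm-nonincreasing lifts.  Assertion (ii) makes [Ec0 f] separate the
   points of [Y], so [Lambda] is also injective, hence isometric.  That the
   bound in (ii) is not the sharp one does not matter, since the isometry comes
   from the lifts. *)
From HB Require Import structures.
Require Import Defs.
From mathcomp Require Import all_boot all_order all_algebra.
From mathcomp Require Import all_classical all_reals all_analysis.
From mathcomp Require Import ring lra.

Set Implicit Arguments.
Unset Strict Implicit.
Unset Printing Implicit Defensive.

Import Order.TTheory GRing.Theory Num.Theory.
Import numFieldNormedType.Exports.

Local Open Scope classical_set_scope.
Local Open Scope ring_scope.

(** * Helly's theorem for finitely many functionals *)

Lemma dual_sumE (R : realType) (X : normedModType R) (I : Type) (s : seq I)
    (y : I -> dual X) x : (\sum_(i <- s) y i) x = \sum_(i <- s) y i x.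
Proof. by elim/big_rec2: _ => // i r g _ <-. Qed.

(** If the value vectors of the ball of radius [r] stay away from [p], the residual at an almost
    nearest one gives coefficients [a] violating the hypothesis. Near-minimizers are used because
    the ball need not be compact. *)
Lemma helly (R : realType) (X : normedModType R) (N : nat)
    (y : 'I_N -> dual X) (p : 'I_N -> R) (r : R) : 0 < r ->
  (forall a : 'I_N -> R,
    \sum_i a i * p i <= r * `|\sum_i a i *: y i|) ->
  forall e, 0 < e -> exists2 z, `|z| <= r & forall i, `|y i z - p i| < e.
Proof.
move=> r0 yp e e0; apply: contrapT => far.
pose q z := \sum_i (p i - y i z) ^+ 2.
pose Q := [set q z | z in [set z : X | `|z| <= r]].
have qe z : `|z| <= r -> e ^+ 2 <= q z.
  move=> zr; rewrite leNgt; apply/negP => qlt; apply: far.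
  exists z => // i; rewrite -(ltr_pXn2r (n := 2)) ?nnegrE ?normr_ge0 ?(ltW e0)//.
  rewrite real_normK ?num_real//; apply: le_lt_trans qlt.
  rewrite /q (bigD1 i)//= -sqrrN opprB lerDl.
  by apply: sumr_ge0 => j _; rewrite sqr_ge0.
have Qinf : has_inf Q.
  split; first by exists (q 0), 0 => //=; rewrite normr0 ltW.
  by exists (e ^+ 2) => _ [z /= zr <-]; exact: qe.
pose d := inf Q.
have d0 : 0 < d.
  apply: (@lt_le_trans _ _ (e ^+ 2)); first by rewrite exprn_gt0.
  by apply: lb_le_inf; [exact: Qinf.1|move=> _ [z /= zr <-]; exact: qe].
have dq z : `|z| <= r -> d <= q z.
  by move=> zr; apply: ge_inf; [exact: Qinf.2|exists z].
pose D := \sum_i (`|y i| * (r + r)) ^+ 2.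
have D0 : 0 <= D by apply: sumr_ge0 => i _; rewrite sqr_ge0.
(* Step length from [z] towards a point of the ball: [t <= 1] stays inside by convexity. The slack
   [t ^+ 2] of near-minimality and the quadratic term, at most [t ^+ 2 * D], add up to at most
   [t * d]. *)
pose t := Num.min 1 (d / (1 + D)).
have D1 : 0 < 1 + D by rewrite ltr_wpDr.
have t0 : 0 < t by rewrite lt_min ltr01 divr_gt0.
have t1 : t <= 1 by rewrite ge_min lexx.
have tD : t * (1 + D) <= d by rewrite -ler_pdivlMr// ge_min lexx orbT.
have [_ [z /= zr <-] qz] := inf_adherent (exprn_gt0 2 t0) Qinf.
pose a i := p i - y i z.
pose g := \sum_i a i *: y i.
have gE w : g w = \sum_i a i * y i w by rewrite dual_sumE.
(* The first order condition at the almost nearest point [z]. *)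
have gle w : `|w| <= r -> g w <= g z + d / 2.
  move=> wr.
  have zwr : `|z + t *: (w - z)| <= r.
    have -> : z + t *: (w - z) = (1 - t) *: z + t *: w.
      by rewrite scalerBr scalerBl scale1r addrAC addrA.
    rewrite (le_trans (ler_normD _ _))// !normrZ !ger0_norm ?subr_ge0 ?(ltW t0)//.
    have -> : r = (1 - t) * r + t * r by rewrite -mulrDl subrK mul1r.
    by rewrite lerD ?ler_wpM2l ?subr_ge0 ?(ltW t0).
  pose T := \sum_i (y i (w - z)) ^+ 2.
  have TD : T <= D.
    apply: ler_sum => i _; rewrite -real_normK ?num_real//.
    rewrite ler_pXn2r ?nnegrE ?normr_ge0 ?mulr_ge0 ?addr_ge0 ?(ltW r0)//.
    rewrite (le_trans (dual_norm_apply_le _ _))// ler_wpM2l//.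
    by rewrite (le_trans (ler_normB _ _))// lerD.
  have qE : q (z + t *: (w - z)) = q z - 2 * t * (g w - g z) + t ^+ 2 * T.
    rewrite /T !gE /q -sumrB !mulr_sumr -sumrB -big_split/=.
    apply: eq_bigr => i _; rewrite linearD linearZ/= linearB/= /a /GRing.scale/=.
    ring.
  have := dq _ zwr; rewrite qE => ineq.
  have h2 : t ^+ 2 * T <= t ^+ 2 * D by rewrite ler_wpM2l ?sqr_ge0.
  have h1 : d <= d + t ^+ 2 - 2 * t * (g w - g z) + t ^+ 2 * D.
    by move: qz; rewrite -/d; lra.
  have : t * (2 * (g w - g z)) <= t * (t * (1 + D)) by lra.
  by rewrite ler_pM2l//; lra.
have gN : r * `|g| <= g z + d / 2.
  rewrite mulrC -ler_pdivlMr//; apply: dual_norm_le => [|x].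
    have := gle 0; rewrite normr0 linear0 => /(_ (ltW r0)) ge0.
    by rewrite divr_ge0 ?(ltW r0).
  have [->|x0] := eqVneq x 0; first by rewrite linear0 !normr0 mulr0.
  have nx0 : 0 < `|x| by rewrite normr_gt0.
  have gx u : `|u| = `|x| -> g u <= (g z + d / 2) / r * `|x|.
    move=> ux; have := gle ((r / `|x|) *: u).
    rewrite normrZ ux normrM normfV normr_id gtr0_norm// mulfVK ?gt_eqF//.
    move=> /(_ (lexx _)); rewrite linearZ/= /GRing.scale/= => h.
    have -> : g u = r / `|x| * g u / r * `|x| by field; rewrite !gt_eqF.
    by rewrite ler_wpM2r// ler_wpM2r// invr_ge0 ltW.
  by rewrite ler_norml gx// andbT lerNl -linearN gx// normrN.
(* The pairing of [a] with [p] is [g z + q z], and [q z >= d > d / 2] contradicts [gN]. *)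
have := yp a; rewrite -/g; apply/negP; rewrite -ltNge; apply: le_lt_trans gN _.
have -> : \sum_i a i * p i = g z + q z.
  rewrite gE /q -big_split/=; apply: eq_bigr => i _; rewrite /a; ring.
by rewrite ltrD2l (lt_le_trans _ (dq z zr))// ltr_pdivrMr// ltr_pMr ?ltr1n.
Qed.

(** * Extension to $c_0$ and representation by an $\ell^1$ sequence *)

(* [S x M] says that the coordinates of [x] after the current one [g x] are
   bounded by [M].  After choosing [c] as the value of the extension at the
   current unit vector, the budget [C] left for the [ell1] norm drops by [`|c|]. *)
Lemma extend_step (R : realType) (X : lmodType R) (S : X -> R -> Prop)
    (psi g : {linear X -> R^o}) (C : R) :
  (forall x y M N, S x M -> S y N -> S (x + y) (M + N)) ->
  (forall a x M, 0 < a -> S x M -> S (a *: x) (a * M)) ->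
  S 0 1 ->
  (forall x M, S x M -> `|g x| <= M -> psi x <= C * M) ->
  exists c, forall x M, S x M -> 0 <= M -> psi x - c * g x <= (C - `|c|) * M.
Proof.
move=> SD SZ S0 SC.
(* One-dimensional Hahn-Banach step: coefficient $1$ on the new unit vector bounds its value above
   by the elements of [A], coefficient $-1$ bounds it below. Adding one vector of each kind cancels
   the coefficients, so the bounds are compatible and [inf A] is admissible. *)
pose A := [set z.2 * C - psi z.1 | z in
  [set z : X * R | S z.1 z.2 /\ `|g z.1 + 1| <= z.2]].
have A0 : A !=set0.
  by exists (1 * C - psi 0), (0, 1) => //=; rewrite linear0 add0r normr1.
have Alb x M : S x M -> `|g x - 1| <= M -> lbound A (psi x - M * C).
  move=> Sx gx _ [[y N] /= [Sy gy] <-].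
  have := SC _ _ (SD _ _ _ _ Sx Sy); rewrite !linearD => /(_ _).
  have gxy : `|g x + g y| <= M + N.
    have -> : g x + g y = (g x - 1) + (g y + 1) by lra.
    by rewrite (le_trans (ler_normD _ _))// lerD.
  by move=> /(_ gxy) /= h; lra.
have Ainf : has_inf A.
  by split => //; exists (psi 0 - 1 * C); apply: Alb => //; rewrite linear0 sub0r normrN1.
exists (inf A).
have up x M : S x M -> `|g x + 1| <= M -> psi x + inf A <= C * M.
  move=> Sx gx; have : inf A <= M * C - psi x.
    by apply: ge_inf; [exact: Ainf.2|exists (x, M)].
  by lra.
have lo x M : S x M -> `|g x - 1| <= M -> psi x - inf A <= C * M.
  move=> Sx gx; have : psi x - M * C <= inf A by apply: lb_le_inf A0 (Alb _ _ Sx gx).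
  by lra.
(* The coefficient [u - g x] makes the current coordinate equal to [u]; homogeneity reduces it to
   $0$ or $\pm1$. *)
have key x M u : S x M -> `|u| <= M -> psi x + inf A * (u - g x) <= C * M.
  move=> Sx uM; set v := u - g x.
  have [v0|v0|v0] := ltgtP v 0; last first.
  - by rewrite v0 mulr0 addr0 SC// -(_ : u = g x)//; apply/eqP; rewrite -subr_eq0 -/v v0.
  - have vi : 0 < v^-1 by rewrite invr_gt0.
    have := up _ _ (SZ _ _ _ vi Sx); rewrite !linearZ/= /GRing.scale/=.
    have -> : v^-1 * g x + 1 = v^-1 * u by rewrite /v; field; rewrite gt_eqF.
    rewrite normrM gtr0_norm// ler_pM2l// => /(_ uM).
    rewrite -(ler_pM2l v0) mulrDr (mulVKf (lt0r_neq0 v0)).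
    rewrite [v * (C * _)]mulrCA (mulVKf (lt0r_neq0 v0)); lra.
  - have w0 : 0 < - v by rewrite oppr_gt0.
    have vi : 0 < (- v)^-1 by rewrite invr_gt0.
    have := lo _ _ (SZ _ _ _ vi Sx); rewrite !linearZ/= /GRing.scale/=.
    have -> : (- v)^-1 * g x - 1 = (- v)^-1 * u.
      apply: (mulfI (lt0r_neq0 w0)).
      by rewrite mulrBr !(mulVKf (lt0r_neq0 w0)) mulr1 /v; ring.
    rewrite normrM gtr0_norm// ler_pM2l// => /(_ uM).
    rewrite -(ler_pM2l w0) mulrBr (mulVKf (lt0r_neq0 w0)).
    rewrite [- v * (C * _)]mulrCA (mulVKf (lt0r_neq0 w0)); lra.
(* Taking [u] to be [M] with the sign of [inf A] produces the term [|c| * M]. *)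
move=> x M Sx M0.
have [c0|c0] := leP 0 (inf A).
  by have := key _ _ M Sx; rewrite (ger0_norm M0) (ger0_norm c0) => /(_ (lexx _)); lra.
by have := key _ _ (- M) Sx; rewrite normrN (ger0_norm M0) (ltr0_norm c0) => /(_ (lexx _)); lra.
Qed.

(* The extension to [c0] takes no maximality argument: its values [xi n] on the
   unit vectors are chosen one after the other.  The stated inequality is the
   bound [C] for the extension to the first [n] unit vectors, optimized over
   their coefficients. *)
Lemma ell1_representation (R : realType) (X : lmodType R)
    (f : nat -> {linear X -> R^o}) (phi : {linear X -> R^o}) (C : R) :
  (forall x M, 0 <= M -> (forall k, `|f k x| <= M) -> phi x <= C * M) ->
  exists xi : nat -> R, forall n x M, 0 <= M ->
    (forall k, (n <= k)%N -> `|f k x| <= M) ->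
    phi x - \sum_(k < n) xi k * f k x <= (C - \sum_(k < n) `|xi k|) * M.
Proof.
move=> phiC.
pose P (s : seq R) := forall x M, 0 <= M ->
  (forall k, (size s <= k)%N -> `|f k x| <= M) ->
  phi x - \sum_(k < size s) s`_k * f k x <= (C - \sum_(k < size s) `|s`_k|) * M.
(* The implication sits under the existential so that [choice] yields a total function of [s]; the
   value is $0$ when [P s] fails. *)
have step s : exists c, P s -> P (rcons s c).
  have [Ps|nPs] := pselect (P s); last by exists 0.
  pose psi x : R^o := phi x - \sum_(k < size s) s`_k * f k x.
  have psil : linear psi.
    move=> a u v; rewrite /psi linearP scalerBr [in RHS]addrACA -opprD; congr (_ - _).
    rewrite scaler_sumr -big_split/=; apply: eq_bigr => k _.
    by rewrite linearP/= /GRing.scale/=; ring.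
  pose psiL : {linear X -> R^o} := HB.pack psi (GRing.isLinear.Build _ _ _ _ _ psil).
  have [||||c hc] := @extend_step R X
      (fun x M => 0 <= M /\ forall k, (size s < k)%N -> `|f k x| <= M)
      psiL (f (size s)) (C - \sum_(k < size s) `|s`_k|).
  - move=> x y M N [M0 xM] [N0 yN]; split; first exact: addr_ge0.
    by move=> k sk; rewrite linearD (le_trans (ler_normD _ _))// lerD ?xM ?yN.
  - move=> a x M a0 [M0 xM]; split; first by rewrite mulr_ge0// ltW.
    by move=> k sk; rewrite linearZ normrM gtr0_norm// ler_wpM2l ?xM ?ltW.
  - by split => // k _; rewrite linear0 normr0.
  - move=> x M [M0 xM] gM; apply: Ps => // k; rewrite leq_eqVlt => /predU1P[<-//|].
    exact: xM.
  exists c => _ x M M0; rewrite size_rcons => xM.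
  have := hc x M (conj M0 xM) M0; rewrite /= /psi !big_ord_recr/=.
  rewrite nth_rcons ltnn eqxx.
  under [X in _ -> _ - (X + _) <= _]eq_bigr do rewrite nth_rcons ltn_ord.
  under [X in _ -> _ <= (_ - (X + _)) * _]eq_bigr do rewrite nth_rcons ltn_ord.
  by rewrite !opprD !addrA.
have [h hP] := choice step.
pose s n := iter n (fun s => rcons s (h s)) [::].
have sS n : s n.+1 = rcons (s n) (h (s n)) by [].
have sz n : size (s n) = n by elim: n => // n IH; rewrite sS size_rcons IH.
have Ps n : P (s n).
  elim: n => [|n IH]; last by rewrite sS; exact: hP.
  by move=> x M M0 xM; rewrite !big_ord0 !subr0; apply: phiC => // k; exact: xM.
exists (fun n => h (s n)) => n.
have sE k : (k < n)%N -> (s n)`_k = h (s k).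
  elim: n => // n IH; rewrite ltnS sS nth_rcons sz leq_eqVlt => /predU1P[->|kn].
    by rewrite ltnn eqxx.
  by rewrite kn IH.
move=> x M M0 xM; have := Ps n x M M0; rewrite sz => /(_ xM).
under eq_bigr do rewrite sE//.
by under [X in _ <= (_ - X) * _ -> _]eq_bigr do rewrite sE//.
Qed.

(** * Bounded sequences, evaluation of limits and unit vectors *)

Lemma bounded_seqP (R : realType) (E : normedModType R) (z_ : nat -> E) :
  bounded_fun z_ <-> exists M, forall k, `|z_ k| <= M.
Proof.
have FF : ProperFilter (globally [set: nat]).
  exact: (globally_properfilter (a := 0%N)).
split=> [/ex_bound[M zM]|[M zM]].
  by exists M => k; exact: zM.
by apply/ex_bound; exists M => k _; exact: zM.
Qed.

Lemma dual_cvg_apply (R : realType) (X : normedModType R) (u : nat -> dual X)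
    (g : dual X) x : u @ \oo --> g -> (fun n => u n x) @ \oo --> g x.
Proof.
move=> /cvgrPdist_le ug; apply/cvgrPdist_le => e e0.
have x1 : 0 < `|x| + 1 by rewrite ltr_wpDl.
apply: filterS (ug _ (divr_gt0 e0 x1)) => n un.
rewrite (le_trans (dual_norm_apply_le (g - u n) x))//.
rewrite (le_trans (ler_wpM2r _ un))// mulrAC ler_pdivrMr//.
by rewrite ler_wpM2l ?(ltW e0)// lerDl.
Qed.

Lemma ell1_delta (R : realType) n : @ell1 R (fun k => (k == n)%:R).
Proof.
apply/cvg_ex; exists (1 : R); apply: cvg_near_cst; exists n.+1 => // m /= nm.
rewrite /series/= (bigD1_seq n) ?mem_index_iota ?iota_uniq//= eqxx normr1.
by rewrite big1 ?addr0// => k /negbTE ->; rewrite normr0.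
Qed.

Lemma Vsharp_delta (R : realType) (E : normedModType R) (f : nat -> dual E) n :
  Vsharp f (fun k => (k == n)%:R) = f n.
Proof.
apply: cvg_lim; first exact: norm_hausdorff.
apply: cvg_near_cst; exists n.+1 => // m /= nm.
rewrite /series/= (bigD1_seq n) ?mem_index_iota ?iota_uniq//= eqxx scale1r.
by rewrite big1 ?addr0// => k /negbTE ->; rewrite scale0r.
Qed.

(** * Convergence against [Y] and the restriction map *)

Section NormingSequence.
Variables (R : realType) (E : normedModType R) (f : nat -> dual E).
Hypothesis f_le1 : forall n, `|f n| <= 1.

Lemma coord_in_Y n : f n \in Y_pred f_le1.
Proof.
by apply/asboolP; exists (fun k => (k == n)%:R); [exact: ell1_delta|exact: Vsharp_delta].
Qed.

Definition coordY n : Y f_le1 := MkY (coord_in_Y n).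

Lemma Vsharp_in_Y xi : ell1 xi -> Vsharp f xi \in Y_pred f_le1.
Proof. by move=> xi1; apply/asboolP; exists xi. Qed.

Lemma Y_sumE (I : Type) (s : seq I) (y : I -> Y f_le1) x :
  (\sum_(i <- s) y i) x = \sum_(i <- s) y i x.
Proof. by elim/big_rec2: _ => // i r g _ <-. Qed.

Lemma Vsharp_apply_cvg xi x : ell1 xi ->
  series (fun n => xi n * f n x) @ \oo --> Vsharp f xi x.
Proof.
move=> xi1; have := dual_cvg_apply (x := x) (Vsharp_cvg f_le1 xi1).
by under eq_fun do rewrite /series/= dual_sumE.
Qed.

(** Partial sums of [Vsharp f xi] converge in the norm of [dual E], so on a bounded sequence the
    tail is uniformly small and only finitely many coordinates remain. *)
Lemma coordinatewise_cvg_Y (z_ : nat -> E) (z : E) : bounded_fun z_ ->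
  (forall n, f n (z_ k) @[k --> \oo] --> f n z) ->
  forall y : Y f_le1, y (z_ k) @[k --> \oo] --> y z.
Proof.
move=> /bounded_seqP[M zM] fz [_ /= /asboolP[xi xi1 <-]].
have M0 : 0 <= M by exact: le_trans (zM 0%N).
apply/cvgrPdist_le => e e0.
have K0 : 0 < M + `|z| + 1 by rewrite ltr_wpDl// addr_ge0.
have e2 : 0 < e / 2 by rewrite divr_gt0.
have /cvgrPdist_le/(_ _ (divr_gt0 e2 K0))[m _ /(_ m (leqnn m))/=] :=
  Vsharp_cvg f_le1 xi1.
set s := series _ m; set y := Vsharp f xi => ys.
have sE w : s w = \sum_(0 <= i < m) xi i * f i w by rewrite /s /series/= dual_sumE.
have : s (z_ k) @[k --> \oo] --> s z.
  under eq_fun do rewrite sE; rewrite sE.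
  by apply: cvg_big => [|i _]; [exact: add_continuous|apply: cvgMl_tmp]; exact: fz.
move=> /cvgrPdist_le/(_ _ e2); apply: filterS => k sk.
have -> : y z - y (z_ k) = (y - s) (z - z_ k) + (s z - s (z_ k)).
  have bE w : (y - s) w = y w - s w by [].
  have -> : (y - s) (z - z_ k) = (y - s) z - (y - s) (z_ k) by exact: linearB.
  by rewrite !bE; ring.
rewrite (le_trans (ler_normD _ _))// [leRHS]splitr lerD//.
rewrite (le_trans (dual_norm_apply_le _ _))//.
rewrite (le_trans (ler_wpM2r _ ys))// mulrAC ler_pdivrMr// ler_wpM2l ?(ltW e2)//.
by rewrite (le_trans (ler_normB _ _))// addrC -addrA lerD// lerDl.
Qed.

Lemma Lambda_is_linear : linear (Lambda (f_le1 := f_le1)).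
Proof. by move=> a u v; apply: dualP. Qed.

Lemma Lambda_norm_le (y : Y f_le1) : `|Lambda y| <= `|y|.
Proof.
apply: dual_norm_le => // x; rewrite (le_trans (dual_norm_apply_le (Y_val y) _))//.
by rewrite ler_wpM2r//; exact: dual_norm_le_Y_norm.
Qed.

Hypothesis f_norming : forall x : E, `|x| = sup (range (fun n => `|f n x|)).

(* Hahn-Banach extension from [Ec0 f] to [c0] followed by [c0^* = ell1]. *)
Lemma Lambda_lift (phi : dual (Ec0 f)) :
  exists2 y : Y f_le1, Lambda y = phi & `|y| <= `|phi|.
Proof.
have phiC (x : Ec0 f) M : 0 <= M -> (forall k, `|Lambda (coordY k) x| <= M) ->
    phi x <= `|phi| * M.
  move=> M0 fM; rewrite (le_trans (ler_norm _))//.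
  rewrite (le_trans (dual_norm_apply_le _ _))// ler_wpM2l// Ec0_normE f_norming.
  apply: ge_sup; first by exists `|f 0%N x|, 0%N.
  by move=> _ [k _ <-]; exact: fM.
have [xi xiP] := @ell1_representation R (Ec0 f) (fun k => Lambda (coordY k)) phi _ phiC.
(* At the vector $0$ with [M] equal to $1$, the inequality [xiP] says that the remaining budget is
   nonnegative. *)
have sumC n : \sum_(k < n) `|xi k| <= `|phi|.
  have := xiP n 0 1 ler01 _; rewrite linear0 big1; last first.
    by move=> k _; rewrite linear0 mulr0.
  rewrite subrr mulr1 subr_ge0; apply => k _.
  by rewrite linear0 normr0.
have xi1 : ell1 xi.
  apply: nondecreasing_is_cvgn.
    by apply/nondecreasing_seqP => n; rewrite /series/= big_nat_recr//= lerDl.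
  by exists `|phi| => _ [n _ <-]; rewrite /series/= big_mkord.
exists (MkY (Vsharp_in_Y xi1)); last first.
  rewrite (le_trans (Y_norm_le xi1 _))// /ell1_norm limr_le//.
  by apply: nearW => n; rewrite /series/= big_mkord.
apply: dualP => x /=.
apply: (@cvg_unique _ (@norm_hausdorff _ R^o) _ _ _ _ (Vsharp_apply_cvg (x := x) xi1)).
apply/cvgrPdist_le => e e0.
have C1 : 0 < `|phi| + 1 by rewrite ltr_wpDl.
have d0 : 0 < e / (`|phi| + 1) by rewrite divr_gt0.
have /asboolP/cvgrPdist_le/(_ _ d0)[N _ xN] := valP x.
exists N => // n /= Nn.
(* For [x] in [Ec0 f] the coordinates from [n] on are small, so the remaining budget bounds the
   error by [e]. The estimate is one-sided and is used at [x] and [- x]. *)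
have le w : (forall k, (n <= k)%N -> `|f k (Ec0_val w)| <= e / (`|phi| + 1)) ->
    phi w - \sum_(k < n) xi k * f k w <= e.
  move=> /(xiP n w _ (ltW d0)) h; apply: (le_trans h).
  rewrite mulrCA ler_piMr ?(ltW e0)// ler_pdivrMr// mul1r.
  by rewrite lerD// (le_trans _ ler01)// oppr_le0 sumr_ge0.
have xn k : (n <= k)%N -> `|f k (Ec0_val x)| <= e / (`|phi| + 1).
  by move=> nk; have := xN k (leq_trans Nn nk); rewrite sub0r normrN.
rewrite /series/= big_mkord ler_norml le//= andbT lerNl opprB.
have fN k : f k (Ec0_val (- x)) = - f k (Ec0_val x) by exact: (linearN (f k)).
have sN : \sum_(k < n) xi k * f k (Ec0_val (- x)) = - \sum_(k < n) xi k * f k x.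
  by rewrite -sumrN; apply: eq_bigr => k _; rewrite fN mulrN.
have := le (- x); rewrite linearN sN opprK [in X in _ -> X]addrC; apply => k nk.
by rewrite fN normrN xn.
Qed.

Lemma Ec0_weakly_dense_Lambda_iso :
  (forall x : E, exists x_ : nat -> Ec0 f,
    bounded_fun x_ /\ forall n, f n (x_ k) @[k --> \oo] --> f n x) ->
  isometric_isomorphism (Lambda (f_le1 := f_le1)).
Proof.
move=> dense.
have inj y1 y2 : Lambda y1 = Lambda y2 :> dual (Ec0 f) -> y1 = y2 :> Y f_le1.
  move=> y12; apply/val_inj/dualP => x.
  have [x_ [/bounded_seqP xb xf]] := dense x.
  have fx : forall y : Y f_le1, y (x_ k) @[k --> \oo] --> y x.
    by apply: coordinatewise_cvg_Y xf; apply/bounded_seqP.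
  apply: (@cvg_unique _ (@norm_hausdorff _ R^o) _ _ _ _ (fx y1)).
  rewrite (_ : (fun k => y1 (x_ k)) = (fun k => y2 (x_ k))); first exact: fx.
  by apply/funext => k; have /(congr1 (fun g => dual_fun g (x_ k))) := y12.
split; first exact: Lambda_is_linear.
  have surj (phi : dual (Ec0 f)) : exists y : Y f_le1, Lambda y = phi.
    by have [y] := Lambda_lift phi; exists y.
  have [g gP] := choice surj.
  by exists g => // y; apply: inj.
move=> y; apply/eqP; rewrite eq_le Lambda_norm_le/=.
(* By injectivity the norm-nonincreasing lift of [Lambda y] is [y] itself, which gives the reverse
   inequality. *)
by have [y' /inj <-] := Lambda_lift (Lambda y).
Qed.

(** For a finite combination [y] of the [f n], [y x] is at most $\|y\|_Y\|x\|=\|\Lambda y\|\,\|x\|$,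
    which is Helly's condition with radius [|x|]. The zero vector is treated apart since [helly]
    needs a positive radius. *)
Lemma Lambda_isometry_Ec0_approx : (forall y : Y f_le1, `|Lambda y| = `|y|) ->
  forall x : E, exists x_ : nat -> Ec0 f,
    (forall k, `|x_ k| <= `|x|) /\
    forall n, f n (x_ k) @[k --> \oo] --> f n x.
Proof.
move=> Liso x; have [->|x0] := eqVneq x 0.
  exists (fun=> 0); split => [k|n]; first by rewrite !normr0.
  exact: cvg_cst.
have nx0 : 0 < `|x| by rewrite normr_gt0.
(* The number of controlled coordinates grows with [k] while the tolerance tends to $0$, so a single
   sequence serves every coordinate. *)
have approx (k : nat) : exists z : Ec0 f, `|z| <= `|x| /\
    forall n, (n < k)%N -> `|f n z - f n x| < k.+1%:R^-1.
  have [||z zx zf] := @helly R (Ec0 f) k (fun i => Lambda (coordY i))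
    (fun i => f i x) `|x| nx0 _ (k.+1%:R^-1).
  - move=> a; pose y : Y f_le1 := \sum_(i < k) a i *: coordY i.
    have -> : \sum_(i < k) a i *: Lambda (coordY i) = Lambda y.
      pose LL := HB.pack (Lambda (f_le1 := f_le1))
        (GRing.isLinear.Build _ _ _ _ _ Lambda_is_linear) : {linear Y f_le1 -> dual (Ec0 f)}.
      rewrite -[RHS]/(LL y) linear_sum; apply: eq_bigr => i _.
      by rewrite linearZ.
    have -> : \sum_(i < k) a i * f i x = y x.
      by rewrite Y_sumE.
    rewrite Liso mulrC (le_trans (ler_norm _))//.
    rewrite (le_trans (dual_norm_apply_le _ _))// ler_wpM2r//.
    exact: dual_norm_le_Y_norm.
  - by rewrite invr_gt0.
  by exists z; split => // n nk; exact: (zf (Ordinal nk)).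
have [x_ x_P] := choice approx.
exists x_; split => [k|n]; first exact: (x_P k).1.
apply/cvgrPdist_le => e e0.
have /cvgrPdist_le/(_ _ e0)[N _ hN] := @cvg_harmonic R.
exists (maxn N n.+1) => // k /=; rewrite geq_max => /andP[Nk nk].
rewrite distrC (le_trans (ltW ((x_P k).2 n nk)))//.
by have := hN k Nk; rewrite sub0r normrN ger0_norm ?harmonic_ge0.
Qed.

End NormingSequence.

Theorem theorem2p2 (R : realType) (E : completeNormedModType R)
    (f : nat -> dual E)
    (f_le1 : forall n, `|f n| <= 1)
    (f_norming : forall x : E, `|x| = sup (range (fun n => `|f n x|)))
    (J_iso : isometric_isomorphism (J f_le1)) :
  let assertion_i := isometric_isomorphism (Lambda (f_le1 := f_le1)) in
  let assertion_ii := forall x : E, exists x_ : nat -> Ec0 f,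
    bounded_fun x_ /\ forall n, f n (x_ k) @[k --> \oo] --> f n x in
  [/\ assertion_i <-> assertion_ii,
      assertion_i /\ assertion_ii ->
        forall x : E, exists x_ : nat -> Ec0 f,
          (forall k, `|x_ k| <= `|x|) /\
          forall n, f n (x_ k) @[k --> \oo] --> f n x
    & forall (z_ : nat -> E) (z : E), bounded_fun z_ ->
        ((forall n, f n (z_ k) @[k --> \oo] --> f n z) <->
         (forall y : Y f_le1, y (z_ k) @[k --> \oo] --> y z))].
Proof.
move=> assertion_i assertion_ii; split.
- split => [[_ _ Liso] x|]; last exact: Ec0_weakly_dense_Lambda_iso.
  have [x_ [x_le x_cvg]] := Lambda_isometry_Ec0_approx Liso x.
  by exists x_; split => //; apply/bounded_seqP; exists `|x|.
- by move=> [[_ _ Liso] _]; exact: Lambda_isometry_Ec0_approx Liso.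
- move=> z_ z zb; split; first exact: coordinatewise_cvg_Y.
  by move=> yz n; exact: (yz (coordY f_le1 n)).
Qed.
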